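(* Let $\mathcal{H}$ be a real Hilbert space and let $\mathcal{F}\subset\mathcal{H}$ be a compact set whose linear span is infinite dimensional. Then the Natural Greedy Algorithm coincides with the Orthogonal Greedy Algorithm: for any realization $\{f_n\}_{n\ge0}$, $\{g_n\}_{n\ge0}$, $\{\mathcal{R}_n\}_{n\ge0}$, $\{V_n\}_{n\ge0}$ of the Natural Greedy Algorithm for $\mathcal{F}$, the sequence $\{g_n\}_{n\ge0}$ is orthonormal, $\mathcal{R}_n(f)=f-\operatorname{proj}(f,V_n)$ for every $f\in\mathcal{H}$ and $n\ge0$, and a sequence $\{f_n\}_{n\ge0}$ in $\mathcal{F}$ is selected by some realization of the Natural Greedy Algorithm if and only if it is selected by some realization of the Orthogonal Greedy Algorithm.
   Context: $\operatorname{proj}(f,V)$ is the orthogonal projection onto the subspace $V$, $\operatorname{dist}(f,V)=\inf_{v\in V}\|f-v\|$. Orthogonal Greedy Algorithm (OGA): for $n=0,1,2,\dots$, with $V_0=\{0\}$ and $V_n=\operatorname{span}\{f_0,\dots,f_{n-1}\}$, choose $f_n\in\mathcal{F}$ with $\operatorname{dist}(f_n,V_n)=\max_{f\in\mathcal{F}}\operatorname{dist}(f,V_n)$. Natural Greedy Algorithm (NGA): a norming functional of $x\ne0$ is a functional $F_x$ with $\|F_x\|=1$ and $F_x(x)=\|x\|$; in a Hilbert space it is $F_x(y)=\langle x,y\rangle/\|x\|$. Set $\mathcal{R}_0(f)=f$ and $V_0=\{0\}$. For $n=0,1,2,\dots$: choose $f_n\in\mathcal{F}$ with $\|\mathcal{R}_n(f_n)\|=\max_{f\in\mathcal{F}}\|\mathcal{R}_n(f)\|$;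 put $g_n=\mathcal{R}_n(f_n)/\|\mathcal{R}_n(f_n)\|$, $r_n(f)=f-F_{g_n}(f)\,g_n$, $\mathcal{R}_{n+1}=r_n\circ\mathcal{R}_n$, and $V_{n+1}=\operatorname{span}\{f_0,\dots,f_n\}$. A realization of either algorithm is any sequence of objects produced by admissible choices. *)

(* Defs.v *)
From mathcomp Require Import all_boot all_order all_algebra.
From mathcomp Require Import sesquilinear.
From mathcomp Require Import all_classical all_reals all_analysis.

Set Implicit Arguments.
Unset Strict Implicit.
Unset Printing Implicit Defensive.

Import Order.TTheory GRing.Theory Num.Theory.
Import numFieldNormedType.Exports.

Local Open Scope classical_set_scope.
Local Open Scope ring_scope.

Definition lspan (R : realType) (H : lmodType R) (A : set H) : set H :=
  [set x | exists n (a : 'I_n -> R) (v : 'I_n -> H),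
    (forall i, A (v i)) /\ x = \sum_(i < n) a i *: v i].

Definition finite_dimensional (R : realType) (H : lmodType R) (W : set H) :=
  exists s : seq H, W = lspan [set` s].

Definition dist_to (R : realType) (H : normedModType R) (f : H) (V : set H) : R :=
  inf [set `|f - v| | v in V].

(* The point of V whose difference with f is orthogonal to V; such a point is
   unique, and exists for every V considered here (a finite-dimensional
   subspace). Otherwise the value is 0. *)
Definition orth_proj (R : realType) (H : lmodType R) (dot : {dot H for idfun})
    (f : H) (V : set H) : H :=
  xget 0 [set p | V p /\ forall v, V v -> dot (f - p) v = 0].

(* The dual norm takes its values in the extended reals, so that a functional of
   norm 1 is in particular bounded. *)
Definition dual_norm (R : realType) (H : normedModType R) (phi : {scalar H}) :
    \bar R :=
  ereal_sup [set `|phi y|%:E | y in [set y : H | `|y| <= 1]].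

Definition norming_functional (R : realType) (H : normedModType R) (x : H)
    (phi : {scalar H}) : Prop :=
  [/\ x != 0, dual_norm phi = 1%:E & phi x = `|x|].

Definition greedy_spaces (R : realType) (H : lmodType R) (f : nat -> H)
    (V : nat -> set H) : Prop :=
  V 0%N = [set 0] /\ forall n, V n.+1 = lspan [set f i | i in `I_n.+1].

Definition OGA (R : realType) (H : normedModType R) (F : set H)
    (f : nat -> H) (V : nat -> set H) : Prop :=
  greedy_spaces f V /\
  forall n, F (f n) /\ forall h, F h -> dist_to h (V n) <= dist_to (f n) (V n).

(* The functional phi is the norming functional of g_n; requiring one to exist
   forces g_n, hence Rn n (f n), to be nonzero, so the division is meaningful. *)
Definition NGA (R : realType) (H : normedModType R) (F : set H)
    (f g : nat -> H) (Rn : nat -> H -> H) (V : nat -> set H) : Prop :=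
  [/\ greedy_spaces f V,
      forall h, Rn 0%N h = h,
      forall n, F (f n) /\ forall h, F h -> `|Rn n h| <= `|Rn n (f n)|,
      forall n, g n = `|Rn n (f n)|^-1 *: Rn n (f n)
    & forall n, exists2 phi : {scalar H}, norming_functional (g n) phi
        & forall h, Rn n.+1 h = Rn n h - phi (Rn n h) *: g n].

Definition orthonormal_seq (R : realType) (H : lmodType R)
    (dot : {dot H for idfun}) (g : nat -> H) : Prop :=
  forall i j, dot (g i) (g j) = (i == j)%:R.

(* Main.v *)
Require Import Defs.
From mathcomp Require Import all_boot all_order all_algebra.
From mathcomp Require Import sesquilinear.
From mathcomp Require Import all_classical all_reals all_analysis.
From mathcomp Require Import ring lra.

Import Order.TTheory GRing.Theory Num.Theory.
Import numFieldNormedType.Exports.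

Local Open Scope classical_set_scope.
Local Open Scope ring_scope.

(** In an inner product space the only norming functional of a unit vector g is
    the inner product with g, so the NGA residuals satisfy the Gram-Schmidt
    recursion R_(n+1) h = R_n h - <g_n, R_n h> g_n. By induction on n, R_n h is
    orthogonal to V_n and h - R_n h lies in V_n, so R_n h = h - proj(h, V_n) and
    |R_n h| = dist(h, V_n): the two greedy criteria agree. Conversely, run this
    recursion on an OGA sequence: a zero residual R_n(f_n) would put all of F
    inside V_n, contradicting that span F is infinite dimensional, so every g_n
    is a unit vector. *)

(** * Linear spans and the greedy spaces *)

Section LinearSpan.
Context {R : realType} {H : lmodType R}.
Implicit Types (A W : set H) (x y : H).

Lemma lspan0 A : lspan A 0.
Proof.
by exists 0%N, (fun=> 0), (fun=> 0); split; [case | rewrite big_ord0].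
Qed.

Lemma sub_lspan A : A `<=` lspan A.
Proof.
move=> x Ax; exists 1%N, (fun=> 1), (fun=> x); split=> //.
by rewrite big_ord1 scale1r.
Qed.

Lemma lspanZ A a x : lspan A x -> lspan A (a *: x).
Proof.
move=> [n [b [v [Av ->]]]]; exists n, (fun i => a * b i), v; split=> //.
by rewrite scaler_sumr; apply: eq_bigr => i _; rewrite scalerA.
Qed.

Lemma lspanD A x y : lspan A x -> lspan A y -> lspan A (x + y).
Proof.
move=> [n [a [v [Av ->]]]] [m [b [w [Aw ->]]]].
exists (n + m)%N, (fun i => match fintype.split i with inl j => a j | inr j => b j end),
  (fun i => match fintype.split i with inl j => v j | inr j => w j end).
split=> [i|]; first by case: (fintype.split i).
rewrite big_split_ord /=; congr (_ + _); apply: eq_bigr => i _.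
  by have := unsplitK (inl i : 'I_n + 'I_m) => /= ->.
by have := unsplitK (inr i : 'I_n + 'I_m) => /= ->.
Qed.

Lemma lspanB A x y : lspan A x -> lspan A y -> lspan A (x - y).
Proof. by move=> Ax Ay; rewrite -scaleN1r; apply/lspanD/lspanZ. Qed.

Lemma lspan_min A W : W 0 -> (forall a x y, W x -> W y -> W (a *: x + y)) ->
  A `<=` W -> lspan A `<=` W.
Proof.
move=> W0 WP AW _ [n [a [v [Av ->]]]].
elim: n a v Av => [|n IHn] a v Av; first by rewrite big_ord0.
rewrite big_ord_recl; apply: WP; first exact/AW/Av.
by apply: (IHn (a \o lift ord0) (v \o lift ord0)) => i; apply: Av.
Qed.

Lemma lspan_sub A B : A `<=` lspan B -> lspan A `<=` lspan B.
Proof.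
apply: lspan_min; first exact: lspan0.
by move=> a x y Bx By; apply: lspanD => //; apply: lspanZ.
Qed.

Lemma lspan_set0 : lspan set0 = [set 0 : H].
Proof.
apply/seteqP; split=> [x|_ ->]; last exact: lspan0.
by apply: lspan_min => // a _ _ -> ->; rewrite scaler0 addr0.
Qed.

Lemma lspan_image_mono (f : nat -> H) m n : (m <= n)%N ->
  lspan (f @` `I_m) `<=` lspan (f @` `I_n).
Proof.
move=> le_mn; apply: lspan_sub => _ [i lt_im <-].
by apply: sub_lspan; exists i => //=; apply: leq_trans le_mn.
Qed.

Lemma finite_dimensional_lspan_image (f : nat -> H) n :
  finite_dimensional (lspan (f @` `I_n)).
Proof.
exists (map f (iota 0 n)); congr lspan; apply/seteqP; split=> x /=.
  by move=> [i lt_in <-]; apply: map_f; rewrite mem_iota.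
by move=> /mapP[i]; rewrite mem_iota => /= lt_in ->; exists i.
Qed.

(** The empty span is the zero space, so one formula also covers [n = 0], which the definition
    treats separately. *)
Lemma greedy_spacesE {f : nat -> H} {V} : greedy_spaces f V ->
  forall n, V n = lspan (f @` `I_n).
Proof.
by move=> [V0 VS] [|n]; rewrite ?VS // V0 II0 image_set0 lspan_set0.
Qed.

End LinearSpan.

(** * Orthogonality and projection errors *)

Section DotProduct.
Context {R : realType} {H : lmodType R} (dot : {dot H for idfun}).
Implicit Types (A : set H) (x y h p r : H).

Lemma dotC x y : dot x y = dot y x.
Proof. by rewrite hermC /= expr0 mul1r. Qed.

Lemma dotDl x y z : dot (x + y) z = dot x z + dot y z.
Proof. exact: linearDl. Qed.

Lemma dotDr x y z : dot z (x + y) = dot z x + dot z y.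
Proof. exact: linearDr. Qed.

Lemma dotZl a x z : dot (a *: x) z = a * dot x z.
Proof. exact: linearZl_LR. Qed.

Lemma dotZr a x z : dot z (a *: x) = a * dot z x.
Proof. exact: linearZr_LR. Qed.

Lemma dotBl x y z : dot (x - y) z = dot x z - dot y z.
Proof. exact: linearBl. Qed.

Lemma dot0l x : dot 0 x = 0. Proof. exact: linear0l. Qed.
Lemma dot0r x : dot x 0 = 0. Proof. exact: linear0r. Qed.

Lemma dot_gt0 x : x != 0 -> 0 < dot x x.
Proof. exact: neq0_dnorm_gt0. Qed.

Lemma dot_ge0 x : 0 <= dot x x.
Proof.
by have [->|x0] := eqVneq x 0; [rewrite dot0l | apply/ltW/dot_gt0].
Qed.

Lemma dot_eq0 x : dot x x = 0 -> x = 0.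
Proof.
by move=> x0; apply/eqP/negPn/negP => /dot_gt0; rewrite x0 ltxx.
Qed.

Lemma dot_lspan A x : (forall v, A v -> dot x v = 0) ->
  forall v, lspan A v -> dot x v = 0.
Proof.
move=> xA; apply: lspan_min => [|a u v xu xv|//]; first exact: dot0r.
by rewrite dotDr dotZr xu xv mulr0 addr0.
Qed.

(** The error of projecting [h] onto the span of [A], stated as a relation: it can be carried
    through an induction before any projection is known to exist. *)
Definition residual A h r :=
  lspan A (h - r) /\ forall v, lspan A v -> dot r v = 0.

(** The point [h - r] is itself a projection, so the default of [xget] is never reached. For the
    chosen [p], the vector [r - (h - p)] lies in the span and is orthogonal to it, hence is 0. *)
Lemma residual_orth_proj {A h r} : residual A h r ->
  r = h - orth_proj dot h (lspan A).
Proof.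
move=> [Ahr rA]; rewrite /orth_proj; case: xgetP => [p _ [Ap pA]|/(_ (h - r))].
  have Arp : lspan A (r - (h - p)).
    have -> : r - (h - p) = p - (h - r) by rewrite !opprB addrCA.
    exact: lspanB.
  apply/eqP; rewrite -subr_eq0; apply/eqP/dot_eq0.
  by rewrite dotBl rA // pA // subr0.
by case; split=> //; rewrite subKr.
Qed.

End DotProduct.

(** * Distances, norming functionals, and the two algorithms *)

Section InnerProductSpace.
Context {R : realType} {H : normedModType R} (dot : {dot H for idfun}).
Context (norm_dot : forall x : H, `|x| = Num.sqrt (dot x x)).
Implicit Types (A F : set H) (x y h r : H).

Lemma sqr_norm_dot x : `|x| ^+ 2 = dot x x.
Proof. by rewrite norm_dot sqr_sqrtr // dot_ge0. Qed.

Lemma dist_to_residual {A h r} : residual dot A h r ->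
  dist_to h (lspan A) = `|r|.
Proof.
move=> [Ahr rA]; apply/eqP; rewrite eq_le; apply/andP; split.
  apply: ge_inf; first by exists 0 => _ [v _ <-].
  by exists (h - r) => //; rewrite subKr.
apply: lb_le_inf; first by exists `|h - 0|; exists 0 => //; apply: lspan0.
move=> _ [v Av <-]; rewrite -(@ler_pXn2r _ 2) ?nnegrE // !sqr_norm_dot.
have Aw : lspan A (h - r - v) by apply: lspanB.
(* Pythagoras: the second summand lies in the span, hence is orthogonal to [r]. *)
have -> : h - v = r + (h - r - v) by rewrite addrA subrKC.
move: (h - r - v) Aw => w Aw.
rewrite dotDl !dotDr (dotC _ w r) (rA _ Aw) addr0 add0r lerDl.
exact: dot_ge0.
Qed.

Lemma cauchy_schwarz x y : `|dot x y| <= `|x| * `|y|.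
Proof.
rewrite -(@ler_pXn2r _ 2) ?nnegrE ?mulr_ge0 // exprMn real_normK ?num_real //.
rewrite !sqr_norm_dot; have [->|x0] := eqVneq x 0.
  by rewrite !dot0l expr0n mul0r.
have x_gt0 := dot_gt0 dot x x0.
(* This square norm is [dot x x * (dot x x * dot y y - dot x y ^+ 2)], and its first factor is
   positive. *)
have := dot_ge0 dot (dot x x *: y - dot x y *: x).
rewrite -scaleNr !(dotDl, dotDr, dotZl, dotZr) (dotC dot y x).
nra.
Qed.

(** Cauchy-Schwarz bounds the dual norm by 1, and [g] itself attains the bound. *)
Lemma norming_functional_dot g : `|g| = 1 -> norming_functional g (dot g).
Proof.
move=> g1; have dotgg : dot g g = 1 by rewrite -sqr_norm_dot g1 expr1n.
split; [by rewrite -normr_gt0 g1 | | by rewrite g1].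
apply/eqP; rewrite eq_le; apply/andP; split.
  apply: ge_ereal_sup => _ [y /= y1 <-]; rewrite lee_fin.
  by apply: le_trans (cauchy_schwarz g y) _; rewrite g1 mul1r.
by apply: ereal_sup_ubound; exists g; rewrite /= ?g1 // dotgg normr1.
Qed.

Lemma dual_norm_le1 (phi : {scalar H}) y : dual_norm phi = 1%:E ->
  `|phi y| <= `|y|.
Proof.
move=> phi1; have [->|y0] := eqVneq y 0; first by rewrite linear0 !normr0.
have y_gt0 : 0 < `|y| by rewrite normr_gt0.
have : (`|phi (`|y|^-1 *: y)|%:E <= dual_norm phi)%E.
  apply: ereal_sup_ubound; exists (`|y|^-1 *: y) => //=.
  by rewrite normrZ normfV normr_id mulVf // gt_eqF.
rewrite phi1 lee_fin linearZ /= normrM normfV normr_id.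
by rewrite ler_pdivrMl // mulr1.
Qed.

(* For z orthogonal to g, (1 + t phi z)^2 <= |g + t z|^2 = 1 + t^2 |z|^2 for
   every t, which forces phi z = 0. *)
Lemma norming_functional_unique g (phi : {scalar H}) : `|g| = 1 ->
  norming_functional g phi -> phi =1 dot g.
Proof.
move=> g1 [_ phi1]; rewrite g1 => phig y.
have dotgg : dot g g = 1 by rewrite -sqr_norm_dot g1 expr1n.
pose z := y - dot g y *: g.
have gz : dot g z = 0 by rewrite /z -scaleNr dotDr dotZr dotgg mulr1 subrr.
suff : phi z = 0.
  rewrite /z linearB linearZ /= phig mulr1 => /eqP.
  by rewrite subr_eq0 => /eqP.
clearbody z; have key t : (1 + t * phi z) ^+ 2 <= 1 + t ^+ 2 * dot z z.
  have := dual_norm_le1 phi (g + t *: z) phi1.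
  rewrite -[X in is_true X -> _](@ler_pXn2r _ 2) ?nnegrE //.
  rewrite real_normK ?num_real // sqr_norm_dot linearD linearZ /= phig !(dotDl, dotDr, dotZl, dotZr).
  by rewrite (dotC dot z g) gz dotgg !mulr0 addr0 add0r mulrA -expr2.
have zz := dot_ge0 dot z.
set a := phi z in key *; set b := dot z z in key zz *.
have b1 : 0 < b + 1 by lra.
(* Adding 1 keeps the denominator positive even for [z = 0]. With [a = t * (b + 1)], [key] becomes
   [t^2 (b + 2) + t^4 (b + 1)^2 <= 0], which forces [t = 0]. *)
have /= := key (a / (b + 1)).
set t := a / (b + 1); have tb : t * (b + 1) = a by rewrite divfK // gt_eqF.
rewrite -tb => keyt; suff -> : t = 0 by rewrite mul0r.
have : t ^+ 2 * (b + 2 + (b + 1) ^+ 2) <= 0.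
  by clearbody t; nra.
rewrite pmulr_lle0; last by nra.
by rewrite le_eqVlt ltNge sqr_ge0 orbF sqrf_eq0 => /eqP.
Qed.

(* If Rn n (f n) = 0 then g n = 0 (since 0^-1 = 0) and the conclusion still
   holds. *)
Lemma residual_gram_schmidt (f g : nat -> H) (Rn : nat -> H -> H) :
  (forall h, Rn 0%N h = h) ->
  (forall n, g n = `|Rn n (f n)|^-1 *: Rn n (f n)) ->
  (forall n h, Rn n.+1 h = Rn n h - dot (g n) (Rn n h) *: g n) ->
  forall n h, residual dot (f @` `I_n) h (Rn n h).
Proof.
move=> R0 gE RS; elim=> [|n IHn] h.
  rewrite /residual R0 subrr; split; first exact: lspan0.
  by rewrite II0 image_set0; apply: dot_lspan.
set A := f @` `I_n; set r := Rn n (f n).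
have [Afr rA] := IHn (f n); have [Ahr RhA] := IHn h.
have AS : lspan A `<=` lspan (f @` `I_n.+1) by apply: lspan_image_mono.
have fnS : lspan (f @` `I_n.+1) (f n) by apply: sub_lspan; exists n => /=.
have rS : lspan (f @` `I_n.+1) r by rewrite -[r](subKr (f n)); apply/lspanB/AS.
have gA v : lspan A v -> dot (g n) v = 0.
  by move=> Av; rewrite gE dotZl rA // mulr0.
split.
  rewrite RS opprB addrCA; apply: lspanD; last exact: AS.
  by rewrite gE; do 2!apply: lspanZ.
have SA v : lspan A v -> dot (Rn n.+1 h) v = 0.
  by move=> Av; rewrite RS -scaleNr dotDl dotZl (gA _ Av) (RhA _ Av) mulr0 addr0.
(* For [r] nonzero, [g n] is [r] normalized, so the update removes exactly the component of [Rn n h]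
   along [r]. *)
have Sr : dot (Rn n.+1 h) r = 0.
  have [r0|r0] := eqVneq r 0; first by rewrite r0 dot0r.
  have nr0 : `|r| != 0 by rewrite normr_eq0.
  rewrite RS -scaleNr dotDl dotZl gE -/r !dotZl -sqr_norm_dot (dotC dot r).
  by field.
apply: dot_lspan => _ [i /= lt_in <-].
move: lt_in; rewrite ltnS leq_eqVlt => /orP[/eqP->|lt_in].
  (* The new generator splits as [f n - r], which lies in the old span, plus [r]. *)
  by rewrite -(subrK r (f n)) dotDr SA // Sr addr0.
by apply/SA/sub_lspan; exists i.
Qed.

(** A norming functional requires [g n] to be nonzero, so [Rn n (f n)] is nonzero and the
    normalization is genuine. *)
Lemma NGA_norm1 {F f g Rn V} n : NGA F f g Rn V -> `|g n| = 1.
Proof.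
move=> [_ _ _ gE /(_ n)[phi [g0 _ _] _]]; move: g0; rewrite gE.
rewrite scaler_eq0 invr_eq0 normr_eq0 orbb => r0.
by rewrite normrZ normfV normr_id mulVf // normr_eq0.
Qed.

Lemma NGA_residual {F f g Rn V} : NGA F f g Rn V ->
  forall n h, residual dot (f @` `I_n) h (Rn n h).
Proof.
move=> nga; have [_ R0 _ gE RS] := nga.
apply: residual_gram_schmidt R0 gE _ => n h.
have [phi phiN ->] := RS n.
by rewrite (norming_functional_unique _ _ (NGA_norm1 n nga) phiN).
Qed.

(** For [i < j], [g i] lies in the span of [f 0, ..., f i], to which the residual defining [g j] is
    orthogonal. *)
Lemma NGA_orthonormal {F f g Rn V} : NGA F f g Rn V -> orthonormal_seq dot g.
Proof.
move=> nga; have [_ _ _ gE _] := nga; have res := NGA_residual nga.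
have g_lt i j : (i < j)%N -> dot (g j) (g i) = 0.
  move=> lt_ij; rewrite gE dotZl (res j (f j)).2 ?mulr0 // gE.
  apply: lspanZ; rewrite -[Rn i _](subKr (f i)); apply: lspanB.
    by apply: sub_lspan; exists i.
  by apply: lspan_image_mono (res i (f i)).1; apply: ltnW.
move=> i j; case: (ltngtP i j) => [lt_ij|lt_ji|->].
- by rewrite dotC g_lt.
- by rewrite g_lt.
- by rewrite -sqr_norm_dot (NGA_norm1 _ nga) expr1n.
Qed.

Lemma NGA_OGA {F f g Rn V} : NGA F f g Rn V -> OGA F f V.
Proof.
move=> nga; have [gs _ fmax _ _] := nga; have res := NGA_residual nga.
split=> // n; have [Ff fmaxn] := fmax n; split=> // h Fh.
by rewrite (greedy_spacesE gs) !(dist_to_residual (res n _)) fmaxn.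
Qed.

(** The direction [g] is inlined so that the recursion depends on [f] alone. Should [S (f m)]
    vanish, [g] is 0 and the residual map is unchanged. *)
Fixpoint gram_schmidt_residual (f : nat -> H) n : H -> H :=
  if n is m.+1 then fun h =>
    let S := gram_schmidt_residual f m in
    let g := `|S (f m)|^-1 *: S (f m) in S h - dot g (S h) *: g
  else id.

Lemma OGA_NGA {F f V} : ~ finite_dimensional (lspan F) -> OGA F f V ->
  exists g Rn, NGA F f g Rn V.
Proof.
move=> infdim [gs fmax]; set Rn := gram_schmidt_residual f.
pose g n := `|Rn n (f n)|^-1 *: Rn n (f n).
(* This holds without knowing that [Rn n (f n)] is nonzero, so it can serve to prove [Rf0]. *)
have res : forall n h, residual dot (f @` `I_n) h (Rn n h).
  exact: (@residual_gram_schmidt f g).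
have Rmax n h : F h -> `|Rn n h| <= `|Rn n (f n)|.
  have [_ fmaxn] := fmax n; move=> /fmaxn.
  by rewrite (greedy_spacesE gs) !(dist_to_residual (res n _)).
have Rf0 n : Rn n (f n) != 0.
  apply/negP => /eqP Rf0; apply: infdim.
  suff -> : lspan F = lspan (f @` `I_n).
    exact: finite_dimensional_lspan_image.
  apply/seteqP; split; apply: lspan_sub; last first.
    by move=> _ [i _ <-]; apply: sub_lspan; have [] := fmax i.
  move=> h Fh.
  have := Rmax n h Fh; rewrite Rf0 normr0 normr_le0 => /eqP Rh0.
  by have := (res n h).1; rewrite Rh0 subr0.
exists g, Rn; split=> // n.
  by have [Ff _] := fmax n; split=> // h; apply: Rmax.
exists (dot (g n)) => //; apply: norming_functional_dot.
by rewrite normrZ normfV normr_id mulVf // normr_eq0.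
Qed.

End InnerProductSpace.

Theorem mainTheorem6 (R : realType) (H : completeNormedModType R)
    (dot : {dot H for idfun})
    (norm_dot : forall x : H, `|x| = Num.sqrt (dot x x))
    (F : set H) (compactF : compact F)
    (infdimF : ~ finite_dimensional (lspan F)) :
  (forall (f g : nat -> H) (Rn : nat -> H -> H) (V : nat -> set H),
     NGA F f g Rn V ->
     orthonormal_seq dot g /\
     forall (h : H) (n : nat), Rn n h = h - orth_proj dot h (V n)) /\
  (forall f : nat -> H, (forall n, F (f n)) ->
     (exists (g : nat -> H) (Rn : nat -> H -> H) (V : nat -> set H),
        NGA F f g Rn V) <->
     (exists V : nat -> set H, OGA F f V)).
Proof.
split=> [f g Rn V nga|f _].
  split=> [|h n]; first exact: NGA_orthonormal nga.
  have [gs _ _ _ _] := nga; rewrite (greedy_spacesE gs).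
  exact: residual_orth_proj (NGA_residual dot norm_dot nga n h).
split=> [[g [Rn [V nga]]]|[V oga]].
  by exists V; apply: NGA_OGA nga.
by have [g [Rn nga]] := OGA_NGA dot norm_dot infdimF oga; exists g, Rn, V.
Qed.
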